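(* Assume that condition $\mathbf{(H)}$ holds. Then the global attractor $\mathcal{M}$ of the semiflow $(\mathcal{U}(t))_{t\ge0}$ on $(\mathbb{L}^2(\Omega))^s_+$ has a finite fractal dimension, i.e. $\dim_f(\mathcal{M})<+\infty$.
   Context: Setting. $\Omega\subset\mathbb{R}^m$ is a bounded open set, $m\in\{1,2,3\}$; $s,r\in\mathbb{N}^*$; $k_1,\dots,k_m,u_1,\dots,u_m$ are positive constants. The real Hilbert lattice $(\mathbb{L}^2(\Omega))^s$ has norm $\|z\|=\big(\sum_{j=1}^s\|z_j\|_{\mathbb{L}^2(\Omega)}^2\big)^{1/2}$, the componentwise a.e. order, and positive cone $(\mathbb{L}^2(\Omega))^s_+=\{z\in(\mathbb{L}^2(\Omega))^s: z_j\ge0,\ j=1,\dots,s\}$. Operator. $\mathcal{A}:(H_0^1(\Omega)\cap H^2(\Omega))^s\to(\mathbb{L}^2(\Omega))^s$ is defined by $(\mathcal{A}z)(x)=\sum_{i=1}^m\big(k_i\frac{\partial^2 z(x)}{\partial x_i^2}-u_i\frac{\partial z(x)}{\partial x_i}\big)$ (acting componentwise); it generates a $C_0$-semigroup $(S(t))_{t\ge0}$ on $(\mathbb{L}^2(\Omega))^s$. Reaction term. For $\kappa=1,\dots,r$ and $j=1,\dots,s$, $l_{j\kappa},r_{j\kappa}\in\mathbb{N}$ are non-negative integers, and $h_\kappa:[0,\infty)\to\mathbb{R}$ is almost everywhere continuous with $0\le h_\kappa(t)\le d_\kappa$ for all $t\ge0$, for some constant $d_\kappa>0$. For $t\ge 0$,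 $F(t,z)=(F_1(t,z),\dots,F_s(t,z))$ with $$F_j(t,z)(x)=\sum_{\kappa=1}^r(r_{j\kappa}-l_{j\kappa})h_\kappa(t)\prod_{\nu=1}^s(z_\nu(x))^{l_{\nu\kappa}},\qquad x\in\Omega$$ (with the convention $y^0=1$). Condition $\mathbf{(H)}$: for each $\kappa\in\{1,\dots,r\}$, either $l_{j\kappa}=0$ for all $j\in\{1,\dots,s\}$, or there exists a unique $j_0\in\{1,\dots,s\}$ such that $l_{j_0\kappa}=1$ and $l_{j\kappa}=0$ for all $j\ne j_0$. Under $\mathbf{(H)}$, $F(t,z)$ is defined for all $z\in(\mathbb{L}^2(\Omega))^s$. Semiflow. For $u_0\in(\mathbb{L}^2(\Omega))^s_+$ and $t\ge0$, $\mathcal{U}(t)u_0:=u(t)$, where $u:[0,\infty)\to(\mathbb{L}^2(\Omega))^s_+$ is the unique mild solution of $u'=\mathcal{A}u+F(t,u)$, $u(0)=u_0$, i.e. $u(t)=S(t)u_0+\int_0^tS(t-\tau)F(\tau,u(\tau))\,d\tau$ for $t\ge0$. The paper treats $(\mathcal{U}(t))_{t\ge0}$ as a semiflow on $(\mathbb{L}^2(\Omega))^s_+$, i.e. $\mathcal{U}(0)=\mathrm{id}$, $\mathcal{U}(t+\tau)=\mathcal{U}(t)\mathcal{U}(\tau)$ for $t,\tau\ge0$, and $t\mapsto\mathcal{U}(t)u_0$ is continuous for each $u_0$. Attraction and attractors. On a complete metric space $(X,d)$ with semiflow $(\mathcal{U}(t))_{t\ge0}$, a set $B\subset X$ attracts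 $C\subset X$ if $\sup_{x\in C}\inf_{y\in B}d(\mathcal{U}(t)x,y)\to0$ as $t\to+\infty$; $B$ is invariant if $\mathcal{U}(t)B=B$ for all $t\ge0$. A global attractor is a closed and bounded invariant subset of $X$ that attracts every bounded subset of $X$. $\mathcal{M}$ denotes the unique connected global attractor of $(\mathcal{U}(t))_{t\ge0}$ on $(\mathbb{L}^2(\Omega))^s_+$, whose existence under $\mathbf{(H)}$ the paper asserts in a preceding theorem. Fractal dimension. $\dim_f(\mathcal{M})=\limsup_{\varepsilon\to0}\ln(N_\varepsilon)/\ln(1/\varepsilon)$, where $N_\varepsilon$ is the smallest $n\in\mathbb{N}$ such that there exist open balls $B_1,\dots,B_n$ of radius $\varepsilon$ (in the norm $\|\cdot\|$ of $(\mathbb{L}^2(\Omega))^s$) with $\mathcal{M}\subset\bigcup_{i=1}^nB_i$. *)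

(* Defs.v *)
From HB Require Import structures.
From mathcomp Require Import all_boot all_order all_algebra.
From mathcomp Require Import all_classical all_reals all_analysis.
From mathcomp Require Import measurable_realfun.

From mathcomp Require Import ring lra.

Set Implicit Arguments.
Unset Strict Implicit.
Unset Printing Implicit Defensive.

Import Order.TTheory GRing.Theory Num.Theory.
Import numFieldNormedType.Exports.

Local Open Scope classical_set_scope.
Local Open Scope ring_scope.

Definition borel_mx_display : measure_display.
Proof. exact. Qed.

Section borel_mx.
Variables (R : realType) (m n : nat).

HB.instance Definition _ := @isMeasurable.Build borel_mx_display 'M[R]_(m, n)
  <<s [set A : set 'M[R]_(m, n) | open A] >>
  (@sigma_algebra0 _ setT _) (@sigma_algebraC _ _) (@sigma_algebra_bigcup _ setT _).

Lemma open_measurable_mx (A : set 'M[R]_(m, n)) : open A -> measurable A.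
Proof. exact: sub_sigma_algebra. Qed.

End borel_mx.

Section lebesgue_measure_rV.
Variable R : realType.

Definition cons_rV m (p : R * 'rV[R]_m) : 'rV[R]_(1 + m) :=
  row_mx p.1%:M p.2.

Definition uncons_rV m (v : 'rV[R]_(1 + m)) : R * 'rV[R]_m :=
  (v ord0 ord0, rsubmx v).

Lemma cons_rVK m : cancel (@cons_rV m) (@uncons_rV m).
Proof.
move=> [x v]; rewrite /uncons_rV /cons_rV row_mxKr; congr pair.
have -> : ord0 = lshift m (ord0 : 'I_1) by exact/val_inj.
by rewrite row_mxEl mxE eqxx mulr1n.
Qed.

Lemma cons_rV0 m (p : R * 'rV[R]_m) : cons_rV p ord0 ord0 = p.1.
Proof. by have := cons_rVK p => /(congr1 fst). Qed.

Lemma cons_rV_lift m (p : R * 'rV[R]_m) i :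
  cons_rV p ord0 (lift ord0 i) = p.2 ord0 i.
Proof.
transitivity ((uncons_rV (cons_rV p)).2 ord0 i); last by rewrite cons_rVK.
by rewrite [RHS]mxE; congr (fun_of_matrix _ _ _); exact/val_inj.
Qed.

Lemma measurable_coord_rV m (i : 'I_m) :
  measurable_fun [set: 'rV[R]_m] (fun v : 'rV[R]_m => v ord0 i : R).
Proof.
apply: (@measurability _ _ 'rV[R]_m (measurableTypeR R) setT _ (@RGenOpens.G R)).
  exact: RGenOpens.measurableE.
move=> _ [A [a [b ->]] <-]; rewrite setTI; apply: open_measurable_mx.
apply: open_comp; last exact: interval_open.
by move=> v _; exact: coord_continuous.
Qed.

Lemma open_prod_rV_measurable m (A : set (R * 'rV[R]_m)) :
  open A -> measurable A.
Proof.
move=> oA.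
pose B (q : rat * 'rV[rat]_m * nat) : set (R * 'rV[R]_m) :=
  ball (ratr q.1.1 : R) (q.2.+1%:R^-1) `*` ball (map_mx ratr q.1.2 : 'rV[R]_m) (q.2.+1%:R^-1).
have -> : A = \bigcup_q (if `[< B q `<=` A >] then B q else set0).
  rewrite eqEsubset; split => [[x v] Axv|xv [q _]]; last first.
    by case: ifPn => // /asboolP; exact.
  have /nbhs_ballP[e /= e0 eA] : nbhs (x, v) A by exact: open_nbhs_nbhs.
  have [n _ /(_ _ (leqnn n)) /= ne] := near_infty_natSinv_lt (PosNum (divr_gt0 e0 (ltr0n R 2))).
  have n0 : 0 < n.+1%:R^-1 :> R by rewrite invr_gt0 ltr0n.
  have H (y : R) : exists q : rat, `|ratr q - y| < n.+1%:R^-1.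
    have /rat_in_itvoo[q] : y - n.+1%:R^-1 < y + n.+1%:R^-1 by rewrite ltrD2l gtrN.
    by rewrite in_itv/= => yq; exists q; rewrite ltr_distl.
  have [q qx] := H x.
  have {H}/choice[w wv] : forall i, exists q : rat, `|ratr q - v ord0 i| < n.+1%:R^-1.
    by move=> i; exact: H.
  exists (q, \row_i w i, n) => //.
  have Bxv : B (q, \row_i w i, n) (x, v).
    split; rewrite /ball //=; split => // i j; rewrite !mxE ord1; exact: wv.
  case: asboolP => // -[] [y u] [/= By Bu]; apply: eA.
  have e2 : n.+1%:R^-1 + n.+1%:R^-1 <= e.
    by rewrite [e]splitr; apply: lerD; exact: ltW.
  split => /=; apply: (le_ball e2).
    exact: (ball_triangle (ball_sym Bxv.1) By).
  exact: (ball_triangle (ball_sym Bxv.2) Bu).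
apply: countable_bigcupT_measurable => // q; case: ifPn => _ //.
apply: measurableX.
- by apply: open_measurable; exact: ball_open.
- by apply: open_measurable_mx; exact: ball_open.
Qed.

Lemma continuous_cons_rV m : continuous (@cons_rV m).
Proof.
move=> [x v] B /nbhs_ballP[e /= e0 eB].
apply/nbhs_ballP; exists e => //= -[y w] [/= xy [_ vw]]; apply: eB.
split => // i j; rewrite /cons_rV !mxE.
by case: split_ordP => k _; rewrite ?mxE ?ord1 ?eqxx ?mulr1n//; exact: vw.
Qed.

Lemma measurable_cons_rV m : measurable_fun [set: R * 'rV[R]_m] (@cons_rV m).
Proof.
apply: (@measurability _ _ (R * 'rV[R]_m)%type 'rV[R]_(1 + m) setT _
  [set A | open A]) => //.
move=> _ [A /= oA <-]; rewrite setTI; apply: open_prod_rV_measurable.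
by apply: open_comp => // p _; exact: continuous_cons_rV.
Qed.

Lemma measurable_uncons_rV m : measurable_fun [set: 'rV[R]_(1 + m)] (@uncons_rV m).
Proof.
apply/measurable_fun_pairP; split.
  exact: (measurable_coord_rV (ord0 : 'I_(1 + m))).
apply: (@measurability _ _ 'rV[R]_(1 + m) 'rV[R]_m setT _
  [set A | open A]) => //.
move=> _ [A /= oA <-]; rewrite setTI; apply: open_measurable_mx.
apply: open_comp => // v _ /= B /nbhs_ballP[e e0 eB].
apply/nbhs_ballP; exists e => // w [_ vw]; apply: eB; split => // i j.
by rewrite !mxE; exact: vw.
Qed.

Section step.
Variables (m : nat) (mu : {sigma_finite_measure set 'rV[R]_m -> \bar R}).

Definition lebesgue_step : set 'rV[R]_(1 + m) -> \bar R :=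
  pushforward (@lebesgue_measure R \x mu)%E (@cons_rV m).

Let image : {measure set 'rV[R]_(1 + m) -> \bar R} :=
  measure_function_pushforward__canonical__measure_function_Measure
    (@lebesgue_measure R \x mu)%E (@measurable_cons_rV m).

Let lebesgue_step0 : lebesgue_step set0 = 0%E.
Proof. exact: (measure0 image). Qed.

Let lebesgue_step_ge0 A : (0 <= lebesgue_step A)%E.
Proof. exact: (measure_ge0 image). Qed.

Let lebesgue_step_sigma_additive : semi_sigma_additive lebesgue_step.
Proof. exact: (@measure_semi_sigma_additive _ _ _ image). Qed.

HB.instance Definition _ := isMeasure.Build _ _ _ lebesgue_step
  lebesgue_step0 lebesgue_step_ge0 lebesgue_step_sigma_additive.

Let lebesgue_step_sigma_finite : sigma_finite setT lebesgue_step.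
Proof.
pose leb : {sigma_finite_measure set (measurableTypeR R) -> \bar R} :=
  @lebesgue_measure R.
have /sigma_finiteP[F [FT ndF Foo]] := sigma_finiteT leb.
have /sigma_finiteP[G [GT ndG Goo]] := sigma_finiteT mu.
exists (fun n => @uncons_rV m @^-1` (F n `*` G n)).
  rewrite -preimage_bigcup [X in _ @^-1` X](_ : _ = setT) ?preimage_setT//.
  rewrite -subTset => -[x v] _.
  have : setT x by []. rewrite FT => -[i _ Fx].
  have : setT v by []. rewrite GT => -[j _ Gv].
  exists (maxn i j) => //; split.
    by move: x Fx; exact/subsetPset/ndF/leq_maxl.
  by move: v Gv; exact/subsetPset/ndG/leq_maxr.
move=> i; have [mF Fi] := Foo i; have [mG Gi] := Goo i; split.
  rewrite -[X in measurable X]setTI; apply: measurable_uncons_rV => //.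
  exact: measurableX.
rewrite /lebesgue_step /pushforward -comp_preimage.
rewrite (_ : _ \o _ = id); last by apply/funext => p; exact: cons_rVK.
rewrite preimage_id product_measure1E// lte_mul_pinfty// ge0_fin_numE//.
Qed.

HB.instance Definition _ := Measure_isSigmaFinite.Build _ _ _ lebesgue_step
  lebesgue_step_sigma_finite.

End step.

Fixpoint lebesgue_rV m : {sigma_finite_measure set 'rV[R]_m -> \bar R} :=
  match m with
  | 0 => [the {sigma_finite_measure set 'rV[R]_0 -> \bar R} of
           dirac (0 : 'rV[R]_0)]
  | m'.+1 => [the {sigma_finite_measure set 'rV[R]_(1 + m') -> \bar R} of
           lebesgue_step (lebesgue_rV m')]
  end.

Lemma measurable_box_rV m (a b : 'I_m -> R) :
  measurable [set v : 'rV[R]_m | forall i, v ord0 i \in `[a i, b i]].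
Proof.
rewrite (_ : mkset _ = \bigcap_(i in setT)
    ((fun v : 'rV[R]_m => v ord0 i) @^-1` `[a i, b i]%classic)); last first.
  by apply/seteqP; split => v /= H i; [move=> _|]; exact: H.
apply: fin_bigcap_measurable => // i _.
by rewrite -[X in measurable X]setTI; exact: measurable_coord_rV.
Qed.

Lemma lebesgue_rV_box m (a b : 'I_m -> R) : (forall i, a i <= b i) ->
  lebesgue_rV m [set v | forall i, v ord0 i \in `[a i, b i]] =
  (\prod_(i < m) (b i - a i))%:E.
Proof.
elim: m => [|m IH] in a b * => ab.
  by rewrite big_ord0 /= diracE mem_set// => -[].
rewrite big_ord_recl /= /lebesgue_step /pushforward.
rewrite (_ : _ @^-1` _ = `[a ord0, b ord0]%classic `*` [set v : 'rV[R]_m |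
    forall i, v ord0 i \in `[a (lift ord0 i), b (lift ord0 i)]]); last first.
  apply/seteqP; split => [[x v] /= xv|[x v] /= [xab vab] i].
    split => [|i]; first by have := xv ord0; rewrite cons_rV0.
    by have := xv (lift ord0 i); rewrite cons_rV_lift.
  by case: (unliftP ord0 i) => [j ->|->]; rewrite ?cons_rV_lift ?cons_rV0.
rewrite product_measure1E//; last first.
  exact: (measurable_box_rV (a \o lift ord0) (b \o lift ord0)).
rewrite IH; last by move=> i; exact: ab.
rewrite EFinM; congr (_ * _)%E.
rewrite (_ : _ `[_, _]%classic =
  @lebesgue_measure R [set` `[a ord0, b ord0]])// lebesgue_measure_itv/= lte_fin.
by have := ab ord0; rewrite le_eqVlt => /orP[/eqP ->|->]; rewrite ?ltxx ?subrr.
Qed.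

End lebesgue_measure_rV.

Local Open Scope quotient_scope.

Section L2.
Context d (T : measurableType d) (R : realType) (mu : {measure set T -> \bar R}).

Definition L2 : Type := LspaceType2 mu.

HB.instance Definition _ := gen_eqMixin L2.
HB.instance Definition _ := gen_choiceMixin L2.

Definition L2_fun (f : L2) : T -> R := (f : {mfun_ mu, T >-> measurableTypeR R}).
Coercion L2_fun : L2 >-> Funclass.

Lemma L2_funP (f : L2) : (f : T -> R) \in Lfun mu 2%:E.
Proof.
apply/andP; split; rewrite inE/=.
  exact: (@measurable_funPT _ _ _ _ (repr (f : {mfun_ mu, T >-> measurableTypeR R}))).

exact: (@Lebesgue_finite _ _ _ _ _ _ f).
Qed.

Lemma L2_ext (f g : L2) : (\forall x \ae mu, f x = g x) -> f = g.
Proof.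
case: f g => [f [[pf]]] [g [[pg]]] fg.
have {fg} E : f = g.
  rewrite -[f]reprK -[g]reprK; apply/eqquotP/asboolP.
  by apply: filterS fg => x.
move: pf pg; rewrite {}E => pf pg.
by rewrite (Prop_irrelevance pf pg).
Qed.

Lemma eq_ae_Lnorm2 (f g : T -> R) : measurable_fun setT f ->
  measurable_fun setT g -> (\forall x \ae mu, f x = g x) ->
  'N[mu]_2%:E[EFin \o f]%E = 'N[mu]_2%:E[EFin \o g]%E.
Proof.
move=> mf mg fg; rewrite unlock /Lnorm; congr (_ `^ _)%E.
apply: ae_eq_integral => //.
- apply: (measurableT_comp (measurable_poweR _)); apply: measurableT_comp => //.
  exact: measurableT_comp.
- apply: (measurableT_comp (measurable_poweR _)); apply: measurableT_comp => //.
  exact: measurableT_comp.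
- by apply: filterS fg => x /= -> _.
Qed.

Section class.
Variables (f : T -> R) (Hf : f \in Lfun mu 2%:E).

Let mf : {mfun T >-> measurableTypeR R} :=
  HB.pack_for {mfun T >-> measurableTypeR R} (f : T -> measurableTypeR R)
    (isMeasurableFun.Build d _ T (measurableTypeR R) f
      (set_mem (sub_Lfun_mfun Hf))).

Let cf : {mfun_ mu, T >-> measurableTypeR R} := \pi mf.

Let cfE : \forall x \ae mu, (cf : T -> R) x = f x.
Proof.
have /eqmodP/asboolP : repr cf = mf
  %[mod {mfun_ mu, T >-> measurableTypeR R}] by rewrite reprK.
by apply: filterS => x /(_ I).
Qed.

Let cf_finite : finite_norm mu 2%:E cf.
Proof.
have := set_mem (sub_Lfun_finLfun Hf); rewrite /finite_norm /=.
move=> ffin; rewrite (@eq_ae_Lnorm2 cf f) //.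
- exact: (@measurable_funPT _ _ _ _ (repr cf)).
- exact: (set_mem (sub_Lfun_mfun Hf)).
Qed.

HB.instance Definition _ := isFinLebesgue.Build d T R mu 2%:E (lee1n 2) cf cf_finite.

Definition L2_class : L2 := [the LspaceType mu (lee1n 2) of cf].

Lemma L2_classE : \forall x \ae mu, L2_class x = f x.
Proof. exact: cfE. Qed.

End class.

Lemma L2_Lfun0 : (cst 0 : T -> R) \in Lfun mu 2%:E.
Proof. exact: (@Lfun_submod_closed _ _ _ mu _ (lee1n 2)).1. Qed.

Lemma L2_LfunZD a (f g : T -> R) : f \in Lfun mu 2%:E -> g \in Lfun mu 2%:E ->
  (a *: f + g) \in Lfun mu 2%:E.
Proof. exact: (@Lfun_submod_closed _ _ _ mu _ (lee1n 2)).2. Qed.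

Lemma L2_LfunD (f g : T -> R) : f \in Lfun mu 2%:E -> g \in Lfun mu 2%:E ->
  (f \+ g) \in Lfun mu 2%:E.
Proof. by move=> Hf Hg; have := L2_LfunZD 1 Hf Hg; rewrite scale1r. Qed.

Lemma L2_LfunZ a (f : T -> R) : f \in Lfun mu 2%:E ->
  (a \*o f) \in Lfun mu 2%:E.
Proof. by move=> Hf; have := L2_LfunZD a Hf L2_Lfun0; rewrite addr0. Qed.

Definition toL2 (f : T -> R) : L2 :=
  match pselect (f \in Lfun mu 2%:E) with
  | left Hf => L2_class Hf
  | right _ => L2_class L2_Lfun0
  end.

Lemma toL2E (f : T -> R) : f \in Lfun mu 2%:E ->
  \forall x \ae mu, toL2 f x = f x.
Proof. by rewrite /toL2; case: pselect => // Hf _; exact: L2_classE. Qed.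

Lemma finite_Lfun_cst c : (mu setT < +oo)%E -> cst c \in Lfun mu 2%:E.
Proof.
move=> muT.
apply/andP; split; rewrite inE//= /finite_norm unlock poweR_lty//.
rewrite (eq_integral (cst ((`|c| `^ 2)%R%:E)))//.
by rewrite integral_cst// lte_mul_pinfty// ?lee_fin ?powR_ge0.
Qed.

Lemma toL2_id (f : L2) : toL2 f = f.
Proof. exact/L2_ext/toL2E/L2_funP. Qed.

Let zero := toL2 (cst 0).
Let opp (f : L2) := toL2 (\- f).
Let add (f g : L2) := toL2 (f \+ g).
Let scale a (f : L2) := toL2 (a \*o f).

Let zeroE : \forall x \ae mu, zero x = 0.
Proof. exact/toL2E/L2_Lfun0. Qed.

Let oppE f : \forall x \ae mu, opp f x = - f x.
Proof.
apply: toL2E; rewrite (_ : \- f = -1 \*o f); first exact/L2_LfunZ/L2_funP.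
by apply/funext => x /=; rewrite mulN1r.
Qed.

Let addE f g : \forall x \ae mu, add f g x = f x + g x.
Proof. by apply: toL2E; apply: L2_LfunD; exact: L2_funP. Qed.

Let scaleE a f : \forall x \ae mu, scale a f x = a * f x.
Proof. by apply: toL2E; apply: L2_LfunZ; exact: L2_funP. Qed.

Let addA : associative add.
Proof.
move=> f g h; apply: L2_ext; near=> x.
rewrite (near (addE f (add g h)) x)// (near (addE g h) x)//.
by rewrite (near (addE (add f g) h) x)// (near (addE f g) x)// addrA.
Unshelve. all: by end_near. Qed.

Let addC : commutative add.
Proof.
move=> f g; apply: L2_ext; near=> x.
by rewrite (near (addE f g) x)// (near (addE g f) x)// addrC.
Unshelve. all: by end_near. Qed.

Let add0 : left_id zero add.
Proof.
move=> f; apply: L2_ext; near=> x.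
by rewrite (near (addE zero f) x)// (near zeroE x)// add0r.
Unshelve. all: by end_near. Qed.

Let addN : left_inverse zero opp add.
Proof.
move=> f; apply: L2_ext; near=> x.
rewrite (near (addE (opp f) f) x)// (near zeroE x)// (near (oppE f) x)//.
by rewrite addNr.
Unshelve. all: by end_near. Qed.

HB.instance Definition _ := GRing.isZmodule.Build L2 addA addC add0 addN.

Let scaleA a b f : scale a (scale b f) = scale (a * b) f.
Proof.
apply: L2_ext; near=> x.
rewrite (near (scaleE a (scale b f)) x)// (near (scaleE b f) x)//.
by rewrite (near (scaleE (a * b) f) x)// mulrA.
Unshelve. all: by end_near. Qed.

Let scale1 : left_id 1 scale.
Proof.
move=> f; apply: L2_ext; near=> x.
by rewrite (near (scaleE 1 f) x)// mul1r.
Unshelve. all: by end_near. Qed.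

Let scaleDr : right_distributive scale +%R.
Proof.
move=> a f g; apply: L2_ext; near=> x.
rewrite (near (scaleE a (f + g)) x)// (near (addE f g) x)//.
rewrite (near (addE (scale a f) (scale a g)) x)//.
by rewrite (near (scaleE a f) x)// (near (scaleE a g) x)// mulrDr.
Unshelve. all: by end_near. Qed.

Let scaleDl f : {morph scale^~ f : a b / a + b}.
Proof.
move=> a b; apply: L2_ext; near=> x.
rewrite (near (scaleE (a + b) f) x)//.
rewrite (near (addE (scale a f) (scale b f)) x)//.
by rewrite (near (scaleE a f) x)// (near (scaleE b f) x)// mulrDl.
Unshelve. all: by end_near. Qed.

HB.instance Definition _ :=
  GRing.Zmodule_isLmodule.Build R L2 scaleA scale1 scaleDr scaleDl.

Lemma L2_0E : \forall x \ae mu, (0 : L2) x = 0.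
Proof. exact: zeroE. Qed.

Lemma L2_oppE (f : L2) : \forall x \ae mu, (- f) x = - f x.
Proof. exact: oppE. Qed.

Lemma L2_addE (f g : L2) : \forall x \ae mu, (f + g) x = f x + g x.
Proof. exact: addE. Qed.

Lemma L2_scaleE a (f : L2) : \forall x \ae mu, (a *: f) x = a * f x.
Proof. exact: scaleE. Qed.

Let norm (f : L2) := fine 'N[mu]_2%:E[EFin \o f]%E.

Let normE (f : L2) : (norm f)%:E = 'N[mu]_2%:E[EFin \o f]%E.
Proof.
rewrite /norm fineK// ge0_fin_numE ?Lnorm_ge0//.
exact: (set_mem (sub_Lfun_finLfun (L2_funP f))).
Qed.

Let mL2 (f : L2) : measurable_fun setT f.
Proof. exact: (set_mem (sub_Lfun_mfun (L2_funP f))). Qed.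

Let normD f g : norm (f + g) <= norm f + norm g.
Proof.
rewrite -lee_fin EFinD !normE.
rewrite (eq_ae_Lnorm2 (mL2 _) (measurable_funD (mL2 f) (mL2 g)) (L2_addE f g)).
by apply: eminkowski; [exact: mL2|exact: mL2|rewrite lee1n].
Qed.

Let normZ a f : norm (a *: f) = `|a| * norm f.
Proof.
apply/EFin_inj; rewrite EFinM !normE.
rewrite (eq_ae_Lnorm2 (mL2 _) (measurable_funM (measurable_cst a) (mL2 f)) (L2_scaleE a f)).
exact: (LnormZ (Lfun_Sub (lee1n 2) (L2_funP f))).
Qed.

Let norm_eq0 f : norm f = 0 -> f = 0.
Proof.
move=> f0; have := @fine_Lnormr_eq0 _ _ _ mu _ (lee1n 2) (Lfun_Sub (lee1n 2) (L2_funP f)) f0.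
move=> {}f0; apply: L2_ext; near=> x; rewrite (near L2_0E x)//.
by apply: (near f0 x).
Unshelve. all: by end_near. Qed.

HB.instance Definition _ := Lmodule_isNormed.Build R L2 normD normZ norm_eq0.

Lemma L2_normE (f : L2) : `|f|%:E = 'N[mu]_2%:E[EFin \o f]%E.
Proof. exact: normE. Qed.

End L2.

Local Close Scope quotient_scope.

Section L2pow.
Context d (T : measurableType d) (R : realType) (mu : {measure set T -> \bar R}).
Variable s : nat.

Definition L2pow : Type := {ffun 'I_s -> L2 mu}.

HB.instance Definition _ := GRing.Lmodule.copy L2pow {ffun 'I_s -> L2 mu}.

Definition L2pow_fun (z : L2pow) : 'I_s -> L2 mu := (z : {ffun 'I_s -> L2 mu}).
Coercion L2pow_fun : L2pow >-> Funclass.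

Let norm (z : L2pow) : R := Num.sqrt (\sum_(j < s) `|z j| ^+ 2).

Let sum_sqr_ge0 (a : 'I_s -> R) : 0 <= \sum_(j < s) a j ^+ 2.
Proof. by apply: sumr_ge0 => j _; exact: sqr_ge0. Qed.

Let cauchy_schwarz (a b : 'I_s -> R) :
  \sum_(j < s) a j * b j <=
  Num.sqrt (\sum_(j < s) a j ^+ 2) * Num.sqrt (\sum_(j < s) b j ^+ 2).
Proof.
set A := Num.sqrt (\sum_j a j ^+ 2); set B := Num.sqrt (\sum_j b j ^+ 2).
have A2 : A ^+ 2 = \sum_j a j ^+ 2 by rewrite sqr_sqrtr.
have B2 : B ^+ 2 = \sum_j b j ^+ 2 by rewrite sqr_sqrtr.
have vanish (c : 'I_s -> R) : \sum_j c j ^+ 2 = 0 -> forall j, c j = 0.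
  move=> /eqP; rewrite psumr_eq0; last by move=> j _; exact: sqr_ge0.
  by move=> /allP c0 j; have := c0 j (mem_index_enum j); rewrite /= sqrf_eq0 => /eqP.
have [A0|A0] := eqVneq A 0.
  rewrite A0 mul0r big1// => j _; rewrite (vanish a) ?mul0r//.
  by rewrite -A2 A0 expr0n.
have [B0|B0] := eqVneq B 0.
  rewrite B0 mulr0 big1// => j _; rewrite (vanish b) ?mulr0//.
  by rewrite -B2 B0 expr0n.
have AB : 0 < A * B by rewrite mulr_gt0// lt0r ?A0 ?B0 sqrtr_ge0.
rewrite -(ler_pM2l AB) mulr_sumr.
have -> : A * B * (A * B) = \sum_j ((B * a j) ^+ 2 + (A * b j) ^+ 2) / 2.
  rewrite -mulr_suml big_split/=.
  under eq_bigr do rewrite exprMn.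
  under [X in _ + X]eq_bigr do rewrite exprMn.
  by rewrite -!mulr_sumr -A2 -B2; field.
apply: ler_sum => j _; rewrite ler_pdivlMr// -subr_ge0.
rewrite (_ : _ - _ = (B * a j - A * b j) ^+ 2); last by ring.
exact: sqr_ge0.
Qed.

Let normD y z : norm (y + z) <= norm y + norm z.
Proof.
rewrite -[leRHS]ger0_norm ?addr_ge0 ?sqrtr_ge0// -sqrtr_sqr ler_wsqrtr//.
rewrite sqrrD !sqr_sqrtr//.
apply: (@le_trans _ _ (\sum_(j < s) (`|y j| + `|z j|) ^+ 2)).
  apply: ler_sum => j _; rewrite ler_sqr ?nnegrE ?addr_ge0//.
  by rewrite /L2pow_fun ffunE ler_normD.
under eq_bigr do rewrite sqrrD.
rewrite !big_split/= lerD2r lerD2l.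
by rewrite mulr2n; apply: lerD; exact: cauchy_schwarz.
Qed.

Let normZ a z : norm (a *: z) = `|a| * norm z.
Proof.
rewrite -sqrtr_sqr -sqrtrM ?sqr_ge0// mulr_sumr; congr Num.sqrt.
apply: eq_bigr => j _.
by rewrite /L2pow_fun ffunE normrZ exprMn real_normK ?num_real.
Qed.

Let norm_eq0 z : norm z = 0 -> z = 0.
Proof.
move=> /eqP; rewrite sqrtr_eq0 => z0; apply/ffunP => j; rewrite ffunE.
have : \sum_(j < s) `|z j| ^+ 2 == 0 by rewrite eq_le z0 sum_sqr_ge0.
rewrite psumr_eq0; last by move=> i _; exact: sqr_ge0.
move=> /allP/(_ j (mem_index_enum j)); rewrite /= sqrf_eq0 normr_eq0.
by move/eqP.
Qed.

HB.instance Definition _ := Lmodule_isNormed.Build R L2pow normD normZ norm_eq0.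

Lemma L2pow_normE (z : L2pow) : `|z| = Num.sqrt (\sum_(j < s) `|z j| ^+ 2).
Proof. by []. Qed.

Definition pos_cone : set L2pow :=
  [set z : L2pow | forall j, \forall x \ae mu, 0 <= z j x].

End L2pow.
Arguments L2pow {d T R} mu s.
Arguments pos_cone {d T R} mu s.

Section bochner.
Context d (T : measurableType d) (R : realType) (mu : {measure set T -> \bar R}).
Variable V : normedModType R.
Implicit Types (g : seq (set T * V)) (D : set T).

(* the list [:: (A_1, v_1); ...; (A_n, v_n)] encodes the simple function
   x |-> \1_A_1(x) v_1 + ... + \1_A_n(x) v_n *)
Definition simple_on D g :=
  {in g, forall p, [/\ measurable p.1, p.1 `<=` D & (mu p.1 < +oo)%E]}.

Definition simple_val g (x : T) : V := \sum_(p <- g) (\1_(p.1) x : R) *: p.2.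

Definition simple_int g : V := \sum_(p <- g) fine (mu p.1) *: p.2.

Definition is_bochner_integral D (f : T -> V) (y : V) :=
  exists g : nat -> seq (set T * V), [/\
    forall n, simple_on D (g n),
    {ae mu, forall x, D x -> simple_val (g n) x @[n --> \oo] --> f x},
    (\int[mu]_(x in D) `|f x - simple_val (g n) x|%:E)%E @[n --> \oo] --> 0%E &
    simple_int (g n) @[n --> \oo] --> y].

End bochner.

Section semigroup.
Context (R : realType) (V : normedModType R).
Implicit Types (S : R -> V -> V) (D : set V) (A : V -> V).

Definition is_C0_semigroup S := [/\
  forall t, 0 <= t -> linear (S t) /\ continuous (S t),
  forall z, S 0 z = z,
  forall t tau z, 0 <= t -> 0 <= tau -> S (t + tau) z = S t (S tau z) &
  forall z, S t z @[t --> 0^'+] --> z].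

Definition generated_by D A S :=
  forall z y, (t^-1 *: (S t z - z) @[t --> 0^'+] --> y) <-> (D z /\ A z = y).

End semigroup.

Section attractor.
Context (R : realType) (V : normedModType R).
Implicit Types (X B C M : set V) (U : R -> V -> V).

Definition is_semiflow X U := [/\
  forall t x, 0 <= t -> X x -> X (U t x),
  forall x, X x -> U 0 x = x,
  forall t tau x, 0 <= t -> 0 <= tau -> X x -> U (t + tau) x = U t (U tau x) &
  forall x, X x -> {within `[0, +oo[, continuous (U^~ x)}].

(* maxe 0 makes the supremum over an empty C equal to 0 rather than -oo *)
Definition semidistance C B : \bar R :=
  maxe 0%E (ereal_sup [set ereal_inf [set `|x - y|%:E | y in B] | x in C]).

Definition attracts U B C := semidistance (U t @` C) B @[t --> +oo] --> 0%E.

Definition invariant U B := forall t, 0 <= t -> U t @` B = B.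

(* closedness is meant in the phase space X; when X is closed, as below,
   it is closedness in V *)
Definition is_global_attractor X U M := [/\
  M `<=` X, closed M, bounded_set M, invariant U M &
  forall C, C `<=` X -> bounded_set C -> attracts U M C].

(* +oo when M has no finite covering by balls of radius e *)
Definition covering_number M (e : R) : \bar R :=
  ereal_inf [set n%:R%:E | n in
    [set n : nat | exists c : 'I_n -> V, M `<=` \bigcup_i ball (c i) e]].

Definition fractal_dim M : \bar R :=
  limf_esup (fun e => lne (covering_number M e) * ((ln e^-1)^-1)%:E)%E 0^'+.

End attractor.

Section sobolev.
Context (R : realType) (m : nat) (Omega : set 'rV[R]_m) (oO : open Omega).

Definition lebesgue_on : {measure set 'rV[R]_m -> \bar R} :=
  mrestr (lebesgue_rV R m) (open_measurable_mx oO).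

Lemma lebesgue_on_lty : bounded_set Omega -> (lebesgue_on setT < +oo)%E.
Proof.
move=> [M [_ bM]]; rewrite /lebesgue_on /= /mrestr setTI.
pose B := [set v : 'rV[R]_m | forall i, v ord0 i \in `[- (`|M| + 1), `|M| + 1]].
have M0 : 0 <= `|M| + 1 by rewrite addr_ge0.
have mB : measurable B by exact: (measurable_box_rV (fun=> - (`|M| + 1)) (fun=> `|M| + 1)).
apply: (@le_lt_trans _ _ (lebesgue_rV R m B)).
  apply: le_measure; rewrite ?inE//; first exact: open_measurable_mx.
  move=> v Ov i; rewrite in_itv/= -ler_norml.
  have vM : `|v| <= `|M| + 1.
    by apply: bM => //; rewrite (le_lt_trans (ler_norm _))// ltrDl.
  apply: (le_trans _ vM); rewrite /Num.norm /= mx_normrE; apply/bigmax_geP; right => /=.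
  by exists (ord0, i).
by rewrite /B lebesgue_rV_box ?ltry// => i; rewrite -subr_ge0 opprK addr_ge0.
Qed.

Local Notation mu := lebesgue_on.
Implicit Types (phi : 'rV[R]_m -> R) (z w : L2 mu) (i : 'I_m).

Definition partial i phi : 'rV[R]_m -> R :=
  fun x => 'D_(delta_mx ord0 i) phi x.

Definition partials (is_ : seq 'I_m) phi : 'rV[R]_m -> R :=
  foldr partial phi is_.

Definition smooth phi := forall is_ : seq 'I_m,
  continuous (partials is_ phi) /\
  forall i x, derivable (partials is_ phi) x (delta_mx ord0 i).

Definition test_function phi := [/\ smooth phi,
  compact (closure [set x | phi x != 0]) &
  closure [set x | phi x != 0] `<=` Omega].

Definition is_weak_partial i z w := forall phi, test_function phi ->
  \int[mu]_x (z x * partial i phi x) = - \int[mu]_x (w x * phi x).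

(* meaningful when z has an i-th weak derivative in L^2, which is then unique *)
Definition weak_partial i z : L2 mu := xget 0 (is_weak_partial i z).

Definition H1 : set (L2 mu) :=
  [set z | forall i, exists w, is_weak_partial i z w].

Definition H2 : set (L2 mu) :=
  [set z | H1 z /\ forall i, H1 (weak_partial i z)].

Definition H1_norm z : R :=
  Num.sqrt (`|z| ^+ 2 + \sum_(i < m) `|weak_partial i z| ^+ 2).

(* the closure of the test functions in H1 *)
Definition H10 : set (L2 mu) :=
  [set z | H1 z /\ forall e, 0 < e ->
     exists2 phi, test_function phi & H1_norm (z - toL2 mu phi) < e].

Variables (s : nat) (k u : 'I_m -> R).

Definition dom_A : set (L2pow mu s) := [set z | forall j, (H10 `&` H2) (z j)].

Definition op_A (z : L2pow mu s) : L2pow mu s :=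
  [ffun j => \sum_(i < m) (k i *: weak_partial i (weak_partial i (z j))
                           - u i *: weak_partial i (z j))].

End sobolev.

Section reaction.
Context (R : realType) (m : nat) (Omega : set 'rV[R]_m) (oO : open Omega).
Context (s r : nat) (l rr : 'I_s -> 'I_r -> nat) (h : 'I_r -> R -> R).

Definition condH := forall kappa : 'I_r,
  (forall j, l j kappa = 0%N) \/
  (exists! j0, l j0 kappa = 1%N /\ forall j, j != j0 -> l j kappa = 0%N).

Definition reaction_fun j t (z : L2pow (lebesgue_on oO) s) (x : 'rV[R]_m) : R :=
  \sum_(kappa < r) ((rr j kappa)%:R - (l j kappa)%:R) * h kappa t *
    \prod_(nu < s) z nu x ^+ l nu kappa.

Definition reaction t (z : L2pow (lebesgue_on oO) s) :
    L2pow (lebesgue_on oO) s :=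
  [ffun j => toL2 _ (reaction_fun j t z)].

Lemma reaction_fun_Lfun j t z : bounded_set Omega -> condH ->
  reaction_fun j t z \in Lfun (lebesgue_on oO) 2%:E.
Proof.
move=> bO hH.
have Lcst c : cst c \in Lfun (lebesgue_on oO) 2%:E.
  apply: finite_Lfun_cst; exact: lebesgue_on_lty.
have -> : reaction_fun j t z = \sum_(kappa < r) (fun x =>
   ((rr j kappa)%:R - (l j kappa)%:R) * h kappa t *
    \prod_(nu < s) z nu x ^+ l nu kappa).
  by apply/funext => x; rewrite fct_sumE.
apply: (big_ind (fun f : 'rV[R]_m -> R => f \in Lfun (lebesgue_on oO) 2%:E)).
- exact: L2_Lfun0.
- by move=> f g; exact: L2_LfunD.
move=> kappa _; apply: (L2_LfunZ _ (f := fun x => \prod_(nu < s) z nu x ^+ l nu kappa)).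
have [l0|[j0 [[lj0 l0] _]]] := hH kappa.
  rewrite (_ : (fun _ => _) = cst 1); first exact: Lcst.
  by apply/funext => x; rewrite big1// => nu _; rewrite l0 expr0.
rewrite (_ : (fun _ => _) = z j0); first exact: L2_funP.
apply/funext => x; rewrite (bigD1 j0)//= lj0 expr1 big1 ?mulr1// => nu nuj0.
by rewrite l0// expr0.
Qed.

(* under condH no junk value of toL2 is involved *)
Lemma reactionE j t z : bounded_set Omega -> condH ->
  \forall x \ae lebesgue_on oO, reaction t z j x = reaction_fun j t z x.
Proof.
by move=> bO hH; rewrite /L2pow_fun ffunE; apply: toL2E; exact: reaction_fun_Lfun.
Qed.

End reaction.

Section mild.
Context (R : realType) (V : normedModType R).
Implicit Types (S F U : R -> V -> V) (X : set V) (u : R -> V) (a : V).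

Definition is_mild_solution X S F a u := [/\
  forall t, 0 <= t -> X (u t),
  {within `[0, +oo[, continuous u} &
  forall t, 0 <= t ->
    is_bochner_integral (@lebesgue_measure R) `[0, t]
      (fun tau => S (t - tau) (F tau (u tau))) (u t - S t a)].

(* U t a is the value at time t of the unique mild solution starting at a *)
Definition solution_operator X S F U := forall a, X a ->
  is_mild_solution X S F a (U^~ a) /\
  forall u, is_mild_solution X S F a u -> forall t, 0 <= t -> u t = U t a.

End mild.

(* Main.v *)
(* Under condition (H) the reaction term is affine in z, so by uniqueness of mild
   solutions each U(t) preserves convex combinations of points of the cone.
   Hence U(t)(nx) - U(t)(ny) = n (U(t)x - U(t)y) for x, y in the cone.  As M is
   bounded and attracts the bounded set nM, the left-hand side has norm at most
   a constant independent of n for all x, y in M once t is large; as U(t)M = M,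
   this forces M to contain at most one point, so its fractal dimension is at
   most 0. *)
Require Import Defs.
From mathcomp Require Import all_boot all_order all_algebra.
From mathcomp Require Import all_classical all_reals all_analysis.
From mathcomp Require Import measurable_realfun.

Import Order.TTheory GRing.Theory Num.Theory.
Import numFieldNormedType.Exports.
Import HBNNSimple.

Set Implicit Arguments.
Unset Strict Implicit.

Local Open Scope classical_set_scope.
Local Open Scope ring_scope.

(* [\int] is a lower integral on functions that are not measurable, such as the
   integrand of the mild formulation when [h] is only a.e. continuous. *)
Lemma ge0_le_integral_off_null d (T : measurableType d) (R : realType)
    (mu : {measure set T -> \bar R}) (D E N : set T) (f g : T -> \bar R) :
  measurable N -> mu N = 0%E -> D `\` N `<=` E ->
  (forall x, D x -> 0 <= f x)%E -> (forall x, E x -> 0 <= g x)%E ->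
  (forall x, (D `\` N) x -> f x <= g x)%E ->
  (\int[mu]_(x in D) f x <= \int[mu]_(x in E) g x)%E.
Proof.
move=> mN N0 DNE f0 g0 fg.
rewrite (ge0_integralE mu f0) (ge0_integralE mu g0).
apply/ge_ereal_sup => /= _ -[p pf <-].
have mNC : measurable (setT `\` N) by exact: measurableD.
(* As [N] is null, cutting [p] off on [N] keeps its integral, and the cut function lies below [g]
   extended by 0 off [E]. *)
rewrite -integralT_nnsfun (@ge0_negligible_integral _ _ _ mu _ N)//; last 2 first.
- by apply/measurable_EFinP; exact: measurable_funPT.
- by move=> x _; rewrite lee_fin; exact: fun_ge0.
rewrite integral_nnsfun// mrestrict.
apply: ereal_sup_ubound; exists (proj_nnsfun p mNC) => // x /=.
rewrite /= -[X in (X%:E <= _)%E]/(p x * \1_(setT `\` N) x).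
have := pf x; rewrite /patch indicE.
have [/set_mem [_ Nx]|_] := boolP (x \in setT `\` N); last first.
  rewrite mulr0 => _; case: ifPn => // /set_mem; exact: g0.
rewrite mulr1; case: ifPn => [/set_mem Dx|/negP xD] pfx.
  have xE : E x by exact: DNE.
  by rewrite mem_set// (le_trans pfx)// fg.
by rewrite (le_trans pfx)//; case: ifPn => // /set_mem; exact: g0.
Qed.

(** * Linearity of the Bochner integral *)

Section simple.
Context d (T : measurableType d) (R : realType) (mu : {measure set T -> \bar R}).
Variable V : normedModType R.
Implicit Types (g : seq (set T * V)) (D : set T).

Definition scale_simple (p : R) g := [seq (a.1, p *: a.2) | a <- g].

Lemma simple_val_scale p g x :
  simple_val (scale_simple p g) x = p *: simple_val g x.
Proof.
rewrite /simple_val big_map scaler_sumr; apply: eq_bigr => a _ /=.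
by rewrite !scalerA mulrC.
Qed.

Lemma simple_val_cat g1 g2 x :
  simple_val (g1 ++ g2) x = simple_val g1 x + simple_val g2 x.
Proof. exact: big_cat. Qed.

Lemma simple_int_scale p g :
  simple_int mu (scale_simple p g) = p *: simple_int mu g.
Proof.
rewrite /simple_int big_map scaler_sumr; apply: eq_bigr => a _ /=.
by rewrite !scalerA mulrC.
Qed.

Lemma simple_int_cat g1 g2 :
  simple_int mu (g1 ++ g2) = simple_int mu g1 + simple_int mu g2.
Proof. exact: big_cat. Qed.

Lemma simple_on_scale D p g : simple_on mu D g -> simple_on mu D (scale_simple p g).
Proof. by move=> gD _ /mapP[a ag ->]; exact: (gD a ag). Qed.

Lemma simple_on_cat D g1 g2 :
  simple_on mu D g1 -> simple_on mu D g2 -> simple_on mu D (g1 ++ g2).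
Proof. by move=> g1D g2D a; rewrite mem_cat => /orP[/g1D|/g2D]. Qed.

(** The shift [v] makes the induction work: a head pair [a] turns [v] into [v + a.2] on [a.1] and
    leaves it alone elsewhere. Only norms are considered, as [V] carries no sigma-algebra. *)
Lemma measurable_norm_simple_val D g v : simple_on mu D g ->
  measurable_fun setT (fun x => `|v + simple_val g x|).
Proof.
elim: g v => [|a g IH] v gD.
  rewrite (_ : (fun _ => _) = cst `|v|); first exact: measurable_cst.
  by apply/funext => x; rewrite /simple_val big_nil addr0.
have aD : measurable a.1 by have [] := gD a (mem_head _ _).
have {}IH w : measurable_fun setT (fun x => `|w + simple_val g x|).
  by apply: IH => b bg; apply: gD; rewrite inE bg orbT.
rewrite (_ : (fun _ => _) = fun x => if x \in a.1 then `|(v + a.2) + simple_val g x|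
    else `|v + simple_val g x|).
  apply: measurable_fun_ifT => //; apply: (measurable_fun_bool true).
  rewrite setTI (_ : _ @^-1` _ = a.1)//.
  by apply/seteqP; split => y; [exact: set_mem|exact: mem_set].
apply/funext => x; rewrite /simple_val big_cons indicE.
by case: ifPn => _; rewrite ?scale1r ?scale0r ?add0r// addrA.
Qed.

(** On [E] this norm is a pointwise limit of norms of simple functions, obtained by appending to
    [g n] the list [w] scaled by -1. *)
Lemma measurable_norm_sub_simple_val D E (g : nat -> seq (set T * V)) (f : T -> V) w :
  (forall n, simple_on mu D (g n)) -> simple_on mu D w ->
  (forall x, E x -> simple_val (g n) x @[n --> \oo] --> f x) ->
  measurable_fun E (fun x => `|f x - simple_val w x|).
Proof.
move=> gD wD gf.
apply: (@measurable_fun_cvg _ _ _ E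
    (fun n x => `|0 + simple_val (g n ++ scale_simple (-1) w) x|)).
  move=> n; apply: (measurable_funS measurableT) => //.
  apply: (@measurable_norm_simple_val D); apply: simple_on_cat => //.
  exact: simple_on_scale.
move=> x Ex; apply: cvg_norm; rewrite /=.
under eq_fun do rewrite add0r simple_val_cat simple_val_scale scaleN1r.
by apply: cvgB; [exact: gf|exact: cvg_cst].
Qed.

(** The combined lists approximate the combined function. The work lies in the integrated error,
    whose integrand need not be measurable on all of [D]. *)
Lemma is_bochner_integral_comb D (f g : T -> V) p q y z :
  measurable D ->
  is_bochner_integral mu D f y -> is_bochner_integral mu D g z ->
  is_bochner_integral mu D (fun x => p *: f x + q *: g x) (p *: y + q *: z).
Proof.
move=> mD [a [aD af aI ay]] [b [bD bg bI bz]].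
pose w n := scale_simple p (a n) ++ scale_simple q (b n).
have wE n x : simple_val (w n) x = p *: simple_val (a n) x + q *: simple_val (b n) x.
  by rewrite simple_val_cat !simple_val_scale.
exists w; split.
- by move=> n; apply: simple_on_cat; exact: simple_on_scale.
- apply: filterS2 af bg => x af bg Dx.
  rewrite (_ : (fun n => _) = fun n =>
      p *: simple_val (a n) x + q *: simple_val (b n) x); last exact/funext.
  by apply: cvgD; apply: cvgZr; [exact: af|exact: bg].
(* Outside the measurable null set [N] both sequences converge on [D], so that the errors are
   measurable on [D] minus [N]. *)
- have [N [mN N0 abN]] : mu.-negligible (~` [set x | D x ->
      simple_val (a n) x @[n --> \oo] --> f x /\
      simple_val (b n) x @[n --> \oo] --> g x]).
    by apply: filterS2 af bg => x af bg Dx; split; [exact: af|exact: bg].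
  have {abN} DN x : (D `\` N) x ->
      simple_val (a n) x @[n --> \oo] --> f x /\
      simple_val (b n) x @[n --> \oo] --> g x.
    by move=> [Dx Nx]; apply: contrapT => nab; apply/Nx/abN => /(_ Dx).
  have mDN : measurable (D `\` N) by exact: measurableD.
  have ma n : measurable_fun (D `\` N) (fun x => `|f x - simple_val (a n) x|%:E).
    apply/measurable_EFinP; apply: (measurable_norm_sub_simple_val aD (aD n)).
    by move=> x /DN[].
  have mb n : measurable_fun (D `\` N) (fun x => `|g x - simple_val (b n) x|%:E).
    apply/measurable_EFinP; apply: (measurable_norm_sub_simple_val bD (bD n)).
    by move=> x /DN[].
  apply: (@squeeze_cvge _ _ _ _ (cst 0%E) _ (fun n =>
    `|p|%:E * (\int[mu]_(x in D) `|f x - simple_val (a n) x|%:E) +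
    `|q|%:E * (\int[mu]_(x in D) `|g x - simple_val (b n) x|%:E))%E).
  (* The lower integral over [D] is bounded by an integral over [D] minus [N], where measurability
     makes additivity available. *)
  + apply: nearW => n; rewrite integral_ge0//=; apply: (@le_trans _ _
      (\int[mu]_(x in D `\` N) (`|p|%:E * `|f x - simple_val (a n) x|%:E +
        `|q|%:E * `|g x - simple_val (b n) x|%:E)))%E.
      apply: (ge0_le_integral_off_null mN N0) => // x _.
        by rewrite -!EFinM -EFinD lee_fin addr_ge0// mulr_ge0.
      rewrite -!EFinM -EFinD lee_fin wE -!normrZ (le_trans _ (ler_normD _ _))//.
      by rewrite !scalerBr opprD addrACA.
    rewrite ge0_integralD//; last 2 first.
    * exact: measurable_funeM.
    * exact: measurable_funeM.
    rewrite !ge0_integralZl_EFin//.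
    (* Back from [D] minus [N] to the larger [D], with an empty exceptional set. *)
    by apply: leeD; apply: lee_wpmul2l => //; rewrite ?lee_fin//;
      apply: (@ge0_le_integral_off_null _ _ _ _ _ _ set0) => // x [[]].
  + exact: cvg_cst.
  + rewrite (_ : 0%E = `|p|%:E * 0 + `|q|%:E * 0)%E; last by rewrite !mule0 adde0.
    by apply: cvgeD => //; exact: cvgeZl.
- rewrite (_ : (fun n => _) = fun n =>
      p *: simple_int mu (a n) + q *: simple_int mu (b n)); last first.
    by apply/funext => n; rewrite simple_int_cat !simple_int_scale.
  by apply: cvgD; exact: cvgZr.
Qed.

Lemma eq_is_bochner_integral D (f g : T -> V) y : {in D, f =1 g} ->
  is_bochner_integral mu D f y -> is_bochner_integral mu D g y.
Proof.
move=> fg [a [aD af aI ay]]; exists a; split => //.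
  by apply: filterS af => x + Dx; rewrite -fg ?inE//; exact.
rewrite (_ : (fun n => _) =
    (fun n => \int[mu]_(x in D) `|f x - simple_val (a n) x|%:E)%E)//.
by apply/funext => n; apply: eq_integral => x xD; rewrite fg.
Qed.

End simple.

(** * Nonnegative combinations in the positive cone *)

Section positive_cone.
Context d (T : measurableType d) (R : realType) (mu : {measure set T -> \bar R}).
Variable s : nat.
Local Notation X := (pos_cone mu s).

Lemma L2pow_combE (y z : L2pow mu s) p q j :
  \forall x \ae mu, (p *: y + q *: z) j x = p * y j x + q * z j x.
Proof.
have -> : (p *: y + q *: z) j = p *: y j + q *: z j by rewrite /L2pow_fun !ffunE.
apply: filterS3 (L2_addE (p *: y j) (q *: z j)) (L2_scaleE p (y j))
  (L2_scaleE q (z j)) => x yz py qz.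
transitivity ((p *: y j) x + (q *: z j) x); first exact: yz.
by congr (_ + _); [exact: py|exact: qz].
Qed.

Lemma pos_cone_comb p q y z : 0 <= p -> 0 <= q ->
  X y -> X z -> X (p *: y + q *: z).
Proof.
move=> p0 q0 Xy Xz j; near=> x; rewrite (near (L2pow_combE y z p q j) x)//.
have y0 : 0 <= y j x by apply: (near (Xy j) x).
have z0 : 0 <= z j x by apply: (near (Xz j) x).
by rewrite addr_ge0// mulr_ge0.
Unshelve. all: by end_near. Qed.

Lemma pos_cone0 : X 0.
Proof.
by move=> j; apply: filterS (L2_0E mu) => x; rewrite /L2pow_fun ffunE => ->.
Qed.

End positive_cone.

(** * Affine behaviour of the reaction and of the solutions *)

(** Under [condH] each monomial is either the constant 1 or a single coordinate [z j0]; the constant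
    case is where [p + q = 1] enters. *)
Lemma reaction_comb (R : realType) (m : nat) (Omega : set 'rV[R]_m)
    (oO : open Omega) (s r : nat) (l rr : 'I_s -> 'I_r -> nat)
    (h : 'I_r -> R -> R) t p q (y z : L2pow (lebesgue_on oO) s) :
  bounded_set Omega -> condH l -> p + q = 1 ->
  reaction l rr h t (p *: y + q *: z) =
  p *: reaction l rr h t y + q *: reaction l rr h t z.
Proof.
move=> bO hH pq; apply/ffunP => j; apply: L2_ext; near=> x.
have yzE nu : (p *: y + q *: z) nu x = p * y nu x + q * z nu x.
  by move: nu; near: x; apply: filter_forall => nu; exact: L2pow_combE.
transitivity (reaction_fun l rr h j t (p *: y + q *: z) x).
  by near: x; exact: reactionE.
transitivity (p * reaction l rr h t y j x + q * reaction l rr h t z j x).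
  rewrite (near (reactionE rr h j t y bO hH) x)//.
  rewrite (near (reactionE rr h j t z bO hH) x)//.
  rewrite /reaction_fun !mulr_sumr -big_split/=; apply: eq_bigr => kappa _.
  have -> : \prod_(nu < s) (p *: y + q *: z) nu x ^+ l nu kappa =
      p * (\prod_(nu < s) y nu x ^+ l nu kappa) +
      q * (\prod_(nu < s) z nu x ^+ l nu kappa).
    have [l0|[j0 [[lj0 l0] _]]] := hH kappa.
      by rewrite !big1 ?mulr1// => nu _; rewrite l0 expr0.
    have prodE w : \prod_(nu < s) L2pow_fun w nu x ^+ l nu kappa = w j0 x.
      rewrite (bigD1 j0)//= lj0 expr1 big1 ?mulr1// => nu nuj0.
      by rewrite l0// expr0.
    by rewrite !prodE yzE.
  by rewrite mulrDr; congr (_ + _); exact: mulrCA.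
by apply/esym; near: x; exact: L2pow_combE.
Unshelve. all: by end_near. Qed.

(** The combination of the two solutions is a mild solution with the combined initial value, so
    uniqueness applies. *)
Lemma solution_operator_comb (R : realType) (V : normedModType R) (X : set V)
    (S F U : R -> V -> V) t p q a b :
  (forall t, 0 <= t -> linear (S t)) ->
  (forall x y, X x -> X y -> X (p *: x + q *: y)) ->
  (forall t x y, F t (p *: x + q *: y) = p *: F t x + q *: F t y) ->
  solution_operator X S F U -> 0 <= t -> X a -> X b ->
  U t (p *: a + q *: b) = p *: U t a + q *: U t b.
Proof.
move=> linS convX Fcomb US t0 Xa Xb.
have Scomb tau x y : 0 <= tau -> S tau (p *: x + q *: y) = p *: S tau x + q *: S tau y.
  move=> tau0; have S0 : S tau 0 = 0.
    by have := linS _ tau0 (-1) 0 0; rewrite scaler0 addr0 scaleN1r addNr.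
  by rewrite linS// -[q *: y]addr0 linS// S0 addr0.
have [[Ua_X Ua_cont Ua_eq] _] := US a Xa.
have [[Ub_X Ub_cont Ub_eq] _] := US b Xb.
have [_ uniq] := US _ (convX _ _ Xa Xb).
apply/esym; apply: (uniq (fun tau => p *: U tau a + q *: U tau b)) t0; split.
- by move=> tau tau0; apply: convX; [exact: Ua_X|exact: Ub_X].
- by move=> x; apply: cvgD; apply: cvgZr; [exact: Ua_cont|exact: Ub_cont].
- move=> tau tau0; rewrite Scomb//.
  rewrite (_ : _ - _ = p *: (U tau a - S tau a) + q *: (U tau b - S tau b)); last first.
    by rewrite !scalerBr addrACA opprD.
  have /(_ (measurable_itv _)) := fun mI =>
    is_bochner_integral_comb p q mI (Ua_eq _ tau0) (Ub_eq _ tau0).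
  (* Membership in the interval matters: [S] is known to be linear only at nonnegative times, here
     [tau - sigma]. *)
  apply: eq_is_bochner_integral => sigma /set_mem.
  by rewrite /= in_itv/= => /andP[_ st]; rewrite Fcomb Scomb// subr_ge0.
Qed.

(** * Dimension of a point and collapse of the attractor *)

(** One ball of any radius suffices, so the logarithm of the covering number is at most 0, while
    [ln e^-1] is nonnegative for [e < 1]. *)
Lemma fractal_dim_subsingleton (R : realType) (V : normedModType R) (M : set V) :
  (forall x y, M x -> M y -> x = y) -> (fractal_dim M <= 0)%E.
Proof.
move=> M1; rewrite /fractal_dim limf_esupE.
apply: (@le_trans _ _ (ereal_sup ((fun e =>
    lne (covering_number M e) * ((ln e^-1)^-1)%:E)%E @` [set e | 0 < e < 1]))).
  apply: ereal_inf_lbound.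
  exists [set e | 0 < e < 1] => //; near=> e; apply/andP; split.
    by near: e; exact: nbhs_right_gt.
  by near: e; exact: nbhs_right_lt.
apply: ge_ereal_sup => _ [e /= /andP[e0 e1] <-].
rewrite mule_le0_ge0 ?lee_fin ?invr_ge0 ?ln_ge0 ?invf_ge1 ?(ltW e1)//.
rewrite lne_le0; apply: ereal_inf_lbound; exists 1%N => //.
have [->|/set0P[x Mx]] := eqVneq M set0; first by exists (fun=> 0); exact: sub0set.
exists (fun=> x) => y My; exists ord0 => //.
by rewrite (M1 y x)//; exact: ballxx.
Unshelve. all: by end_near. Qed.

(** Affinity carries a dilation of two points over to the difference of their images: the offset
    [U t 0], which may be nonzero, cancels. *)
Lemma global_attractor_affine (R : realType) (V : normedModType R)
    (X M : set V) (U : R -> V -> V) :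
  X 0 -> (forall c x, 0 <= c -> X x -> X (c *: x)) ->
  (forall t x y p q, 0 <= t -> 0 <= p -> 0 <= q -> p + q = 1 -> X x -> X y ->
    U t (p *: x + q *: y) = p *: U t x + q *: U t y) ->
  is_global_attractor X U M -> forall x y, M x -> M y -> x = y.
Proof.
move=> X0 XZ Uaff [MX _ Mbnd Minv Mattr] x y Mx My.
have [C [Creal MC]] := Mbnd.
(* [bounded_set] bounds norms only by reals strictly above [C], hence the [+ 1]. *)
pose B := `|C| + 1.
have MB z : M z -> `|z| <= B.
  by apply: MC; rewrite (le_lt_trans (ler_norm _))// ltrDl.
(* The right-hand side is twice the bound [1 + B] of [near_M] and is independent of [n]; for
   distinct [x] and [y], taking [n.+1] above [K] contradicts it. *)
suff H n : n.+1%:R * `|x - y| <= 2 + (B + B).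
  apply/eqP; rewrite -subr_eq0 -normr_eq0 eq_le normr_ge0 andbT leNgt.
  apply/negP => xy; pose K := (2 + (B + B)) / `|x - y|.
  have := H (Num.truncn K); rewrite -ler_pdivlMr// leNgt => /negP; apply.
  by rewrite truncnS_gt.
pose c : R := n.+1%:R; have c0 : 0 < c by rewrite ltr0n.
have c1 : 1 <= c by rewrite ler1n.
have cV1 : c^-1 <= 1 by rewrite invf_le1.
pose E := [set c *: z | z in M].
have EX : E `<=` X by move=> _ [z Mz <-]; apply: XZ; [exact: ltW|exact: MX].
have Ebnd : bounded_set E.
  exists (c * B); split; first by rewrite num_real.
  move=> b cb _ [z Mz <-] /=; rewrite normrZ gtr0_norm//.
  by rewrite (le_trans _ (ltW cb))// ler_pM2l// MB.
(* Any positive threshold would do; the choice of 1 produces the 2 in the bound. *)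
have : \forall t \near +oo, (semidistance (U t @` E) M < 1)%E.
  apply: (Mattr E EX Ebnd [set y | y < 1]%E); apply: open_nbhs_nbhs.
  by split; [exact: open_ereal_lt_ereal|rewrite /= lte_fin].
move=> [t0 [_ Ht]]; pose t := `|t0| + 1.
have t_ge0 : 0 <= t by rewrite addr_ge0.
have {Ht} /Ht : t0 < t by rewrite (le_lt_trans (ler_norm _))// ltrDl.
rewrite /semidistance gt_max => /andP[_ tE].
have near_M z : M z -> `|U t (c *: z)| <= 1 + B.
  move=> Mz.
  have /ereal_inf_lt[_ [w Mw <-]] :
      (ereal_inf [set `|U t (c *: z) - w|%:E | w in M] < 1)%E.
    apply: le_lt_trans tE; apply: ereal_sup_ubound.
    by exists (U t (c *: z)) => //; exists (c *: z) => //; exists z.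
  rewrite lte_fin => zw; rewrite -(subrK w (U t _)).
  by rewrite (le_trans (ler_normD _ _))// lerD ?MB// ltW.
(* Here [z] is the convex combination of [c *: z] and 0 with weights [c^-1] and [1 - c^-1]; affinity
   is applied and the result multiplied by [c]. *)
have scale z : X z -> c *: U t z = U t (c *: z) + (c - 1) *: U t 0.
  move=> Xz; have -> : U t z = U t (c^-1 *: (c *: z) + (1 - c^-1) *: 0).
    by rewrite scaler0 addr0 scalerA mulVf ?scale1r ?gt_eqF.
  have cV : c^-1 + (1 - c^-1) = 1 by rewrite addrC subrK.
  rewrite Uaff ?subr_ge0 ?invr_ge0 ?(ltW c0)//; last by apply: XZ => //; exact: ltW.
  rewrite scalerDr !scalerA mulfV ?gt_eqF// scale1r.
  by rewrite mulrBr mulr1 mulfV ?gt_eqF.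
(* Invariance transfers the estimate at the fixed time [t] to arbitrary points of [M]. *)
have [x' Mx' <-] : (U t @` M) x by rewrite Minv.
have [y' My' <-] : (U t @` M) y by rewrite Minv.
rewrite -[n.+1%:R]gtr0_norm// -normrZ scalerBr !scale//; [|exact: MX|exact: MX].
rewrite opprD addrACA subrr addr0 (le_trans (ler_normB _ _))//.
by rewrite (_ : 2 = 1 + 1)// addrACA lerD// near_M.
Qed.

Unset Implicit Arguments.
Set Strict Implicit.

Theorem theorem5p11 (R : realType) (m s r : nat)
  (hm : (0 < m <= 3)%N) (hs : (0 < s)%N) (hr : (0 < r)%N)
  (Omega : set 'rV[R]_m) (oO : open Omega) (bO : bounded_set Omega)
  (k u : 'I_m -> R) (hk : forall i, 0 < k i) (hu : forall i, 0 < u i)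
  (S : R -> L2pow (lebesgue_on oO) s -> L2pow (lebesgue_on oO) s)
  (hS : is_C0_semigroup S)
  (hAS : generated_by (@dom_A R m Omega oO s) (op_A k u) S)
  (l rr : 'I_s -> 'I_r -> nat) (h : 'I_r -> R -> R) (d : 'I_r -> R)
  (hd : forall kappa, 0 < d kappa)
  (hh : forall kappa t, 0 <= t -> 0 <= h kappa t <= d kappa)
  (hc : forall kappa, {ae (@lebesgue_measure R), forall t,
          0 <= t -> {for t, continuous (h kappa)}})
  (hH : condH l)
  (U : R -> L2pow (lebesgue_on oO) s -> L2pow (lebesgue_on oO) s)
  (hU : solution_operator (pos_cone (lebesgue_on oO) s) S
          (reaction l rr h) U)
  (hUsf : is_semiflow (pos_cone (lebesgue_on oO) s) U)
  (M : set (L2pow (lebesgue_on oO) s))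
  (hM : is_global_attractor (pos_cone (lebesgue_on oO) s) U M)
  (hMc : connected M) :
  (fractal_dim M < +oo)%E.
Proof.
apply: (@le_lt_trans _ _ 0%E); last exact: ltry.
apply: fractal_dim_subsingleton; apply: (global_attractor_affine _ _ _ hM).
- exact: pos_cone0.
- move=> c z c0 Xz; rewrite -[c *: z]addr0 -[X in _ + X](scale0r z).
  exact: pos_cone_comb.
- move=> t x y p q t0 p0 q0 pq; apply: (solution_operator_comb _ _ _ hU) => //.
  + by have [linS _ _ _] := hS => tau /linS[].
  + by move=> a b; exact: pos_cone_comb.
  + by move=> tau a b; exact: reaction_comb.
Qed.
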